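(* Let $n\ge 2$ be an integer. Put $S_n=\sum_{l=1}^{n-1}\csc\frac{\pi l}{n}$ and, for $\nu\in\{1,\ldots,n-1\}$, $C_n(\nu)=\sum_{l=1}^{n-1}\cos\frac{2\pi\nu l}{n}\csc\frac{\pi l}{n}$. Then $$\sum_{\nu=1}^{n-1}\Psi\!\left(\frac{\nu}{n}\right)C_n(\nu)=(\gamma+n\ln 2)\,S_n-n\ln\prod_{\nu=1}^{n-1}\left(\csc\frac{\pi\nu}{n}\right)^{\csc\frac{\pi\nu}{n}}.$$
   Context: $\Psi=\Gamma'/\Gamma$ is the digamma function and $\gamma$ is Euler's constant. *)

(* Defs.v *)
(* Stdlib real numbers with Coquelicot. *)
From Stdlib Require Import Reals.
From Coquelicot Require Import Coquelicot.
Open Scope R_scope.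

(* Euler's integral, improper at both ends: int_0^oo t^(x-1) e^(-t) dt.
   It converges exactly for x > 0, and is only meaningful there. *)
Definition Gamma (x : R) : R :=
  RInt_gen (fun t => Rpower t (x - 1) * exp (- t))
    (at_right 0) (Rbar_locally p_infty).

Definition digamma (x : R) : R := Derive Gamma x / Gamma x.

Definition euler_gamma : R :=
  real (Lim_seq (fun N => sum_n_m (fun k => / INR k) 1 N - ln (INR N))).

Definition csc (x : R) : R := / sin x.

(* Multiplicative counterpart of [sum_n_m]: both bounds are included. *)
Definition prod_n_m (f : nat -> R) (a b : nat) : R :=
  Iter.iter_nat Rmult 1 f a b.

Definition csc_sum (n : nat) : R :=
  sum_n_m (fun l => csc (PI * INR l / INR n)) 1 (n - 1).

Definition cos_csc_sum (n nu : nat) : R :=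
  sum_n_m (fun l => cos (2 * PI * INR nu * INR l / INR n)
                    * csc (PI * INR l / INR n)) 1 (n - 1).

(* Main.v *)
Require Import Defs.
From Stdlib Require Import Reals Lra Lia.
From Coquelicot Require Import Coquelicot.
Open Scope R_scope.

(* Exchanging the two sums reduces the claim to Gauss's formula
     sum_(nu=1)^(n-1) psi(nu/n) cos(2 pi nu l / n) = n ln(2 sin(pi l / n)) + gamma.
   Over a full period nu = 1, ..., n the cosines sum to 0, so psi(nu/n + N), being
   ln N + o(1), contributes nothing in the limit; the recurrence of psi
   then turns the full sum into - n sum_m cos(m theta) / m with theta = 2 pi l / n,
   which is n ln(2 sin(theta / 2)).
   The bounds psi(x) <= ln x <= psi(x + 1) come from integrating tangent-line
   inequalities for ln against the Gamma densities. *)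

(** Every analytic fact about [Gamma] is obtained by integrating a pointwise inequality between
    kernels. Since [t ^ (x + h)] differs from its first-order Taylor polynomial in [h] by at most
    [h ^ 2] times an integrable majorant, differentiating under the integral sign needs no limit
    theorem. The cosine series is only conditionally convergent. Its sum is found by comparison with
    the point [PI], where the partial sums of even length are differences of harmonic numbers and so
    are governed by the same asymptotics of psi. Even lengths suffice, because the shift of the
    digamma arguments can be taken even. The constant gamma is the missing term [nu = n] of a full
    period, namely - psi(1). *)

(** * Integrals over the positive half-line *)

(** [RInt_gen] returns a number even for a divergent integral, so convergence is carried along with
    the value as a relation. *)
Notation is_RInt_pos f l :=
  (is_RInt_gen (f : R -> R) (at_right 0) (Rbar_locally p_infty) (l : R)).

Lemma filter_prod_pos :
  filter_prod (at_right 0) (Rbar_locally p_infty)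
    (fun ab : R * R => 0 < fst ab <= snd ab).
Proof.
  apply Filter_prod with (fun a => 0 < a < 1) (fun b => 1 < b).
  - exists (mkposreal 1 Rlt_0_1). intros y Hy Hy0. split; [exact Hy0|].
    apply Rabs_def2 in Hy. unfold minus, plus, opp in Hy; simpl in Hy. lra.
  - exists 1. auto.
  - simpl. intros; lra.
Qed.

Lemma continuous_pos_ex_RInt (f : R -> R) (a b : R) :
  (forall t, 0 < t -> continuous f t) -> 0 < a -> 0 < b -> ex_RInt f a b.
Proof.
  intros Hf Ha Hb. apply @ex_RInt_continuous. intros z Hz. apply Hf.
  pose proof (Rmin_glb_lt a b 0 Ha Hb). lra.
Qed.

(** The absolute value on the right allows the bounds in either order, as the Cauchy criterion
    compares endpoints whose order is unknown. *)
Lemma Rabs_RInt_dominated (f g : R -> R) (a b : R) :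
  (forall t, 0 < t -> continuous f t) -> (forall t, 0 < t -> continuous g t) ->
  (forall t, 0 < t -> Rabs (f t) <= g t) -> 0 < a -> 0 < b ->
  Rabs (RInt f a b) <= Rabs (RInt g a b).
Proof.
  intros Cf Cg Hfg.
  assert (le_case : forall a b, 0 < a -> 0 < b -> a <= b ->
            Rabs (RInt f a b) <= Rabs (RInt g a b)).
  { intros p q Hp Hq Hpq.
    eapply Rle_trans; [|apply Rle_abs].
    eapply Rle_trans.
    - apply abs_RInt_le; [exact Hpq|]. now apply continuous_pos_ex_RInt.
    - apply RInt_le; [exact Hpq| | |].
      + apply continuous_pos_ex_RInt; try assumption.
        intros t Ht. apply (continuous_comp f Rabs); [now apply Cf|].
        apply @continuous_Rabs.
      + now apply continuous_pos_ex_RInt.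
      + intros t Ht. apply Hfg. lra. }
  intros Ha Hb. destruct (Rle_lt_dec a b) as [H|H].
  - now apply le_case.
  - rewrite <- (opp_RInt_swap f) by now apply continuous_pos_ex_RInt.
    rewrite <- (opp_RInt_swap g) by now apply continuous_pos_ex_RInt.
    unfold opp; simpl. rewrite !Rabs_Ropp. apply le_case; lra.
Qed.

Lemma dominated_ex_RInt_pos (f g : R -> R) (lg : R) :
  (forall t, 0 < t -> continuous f t) -> (forall t, 0 < t -> continuous g t) ->
  (forall t, 0 < t -> Rabs (f t) <= g t) -> is_RInt_pos g lg ->
  exists lf, is_RInt_pos f lf.
Proof.
  intros Cf Cg Hfg Hg.
  assert (Lg : filterlim (fun ab : R * R => RInt g (fst ab) (snd ab))
            (filter_prod (at_right 0) (Rbar_locally p_infty)) (locally lg)).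
  { intros P HP. specialize (Hg P HP). unfold filtermapi in Hg.
    unfold filtermap. eapply filter_imp; [|exact Hg].
    intros ab [y [Hy Py]]. now rewrite (is_RInt_unique _ _ _ _ Hy). }
  pose proof (proj2 (filterlim_locally_cauchy (U := R_CompleteSpace)
    (F := filter_prod (at_right 0) (Rbar_locally p_infty))
    (fun ab : R * R => RInt g (fst ab) (snd ab))) (ex_intro _ lg Lg)) as Cau.
  destruct (proj1 (filterlim_locally_cauchy (U := R_CompleteSpace)
    (F := filter_prod (at_right 0) (Rbar_locally p_infty))
    (fun ab : R * R => RInt f (fst ab) (snd ab)))) as [lf Hlf].
  { intros eps.
    destruct (Cau (pos_div_2 eps)) as [P [HP HC]].
    destruct HP as [Q S HQ HS HP].
    exists (fun ab => (Q (fst ab) /\ 0 < fst ab) /\ (S (snd ab) /\ 0 < snd ab)).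
    split.
    { apply Filter_prod with (fun a => Q a /\ 0 < a) (fun b => S b /\ 0 < b).
      - apply filter_and; [exact HQ|].
        exists (mkposreal 1 Rlt_0_1). intros y _ Hy. exact Hy.
      - apply filter_and; [exact HS|]. exists 0. auto.
      - auto. }
    intros [a b] [a' b']; simpl. intros [[Qa Ha] [Sb Hb]] [[Qa' Ha'] [Sb' Hb']].
    (* Moving one endpoint at a time isolates the integrals of [g] over the two end pieces, each
       smaller than half of [eps]; they dominate the corresponding pieces of [f]. *)
    pose proof (HC (a, b) (a', b) (HP _ _ Qa Sb) (HP _ _ Qa' Sb)) as H1.
    pose proof (HC (a, b) (a, b') (HP _ _ Qa Sb) (HP _ _ Qa Sb')) as H2.
    unfold ball in *; simpl in *; unfold AbsRing_ball, abs, minus, plus, opp in *;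
    simpl in *.
    pose proof (fun h p q (Hp : 0 < p) (Hq : 0 < q) Ch =>
      continuous_pos_ex_RInt h p q Ch Hp Hq) as ex.
    pose proof (RInt_Chasles g a a' b (ex g a a' Ha Ha' Cg) (ex g a' b Ha' Hb Cg)).
    pose proof (RInt_Chasles f a a' b (ex f a a' Ha Ha' Cf) (ex f a' b Ha' Hb Cf)).
    pose proof (RInt_Chasles g a b b' (ex g a b Ha Hb Cg) (ex g b b' Hb Hb' Cg)).
    pose proof (RInt_Chasles f a' b b' (ex f a' b Ha' Hb Cf) (ex f b b' Hb Hb' Cf)).
    unfold plus in *; simpl in *.
    pose proof (Rabs_RInt_dominated f g a a' Cf Cg Hfg Ha Ha').
    pose proof (Rabs_RInt_dominated f g b b' Cf Cg Hfg Hb Hb').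
    replace (RInt f a' b' + - RInt f a b) with (RInt f b b' + - RInt f a a') by lra.
    replace (RInt g a' b + - RInt g a b) with (- RInt g a a') in H1 by lra.
    replace (RInt g a b' + - RInt g a b) with (RInt g b b') in H2 by lra.
    rewrite Rabs_Ropp in H1.
    eapply Rle_lt_trans; [apply Rabs_triang|]. rewrite Rabs_Ropp. lra. }
  exists lf.
  apply (filterlimi_lim_ext_loc (fun ab : R * R => RInt f (fst ab) (snd ab)));
    [|exact Hlf].
  eapply filter_imp; [|apply filter_prod_pos].
  intros ab Hab. apply (RInt_correct (V := R_CompleteNormedModule)).
  apply continuous_pos_ex_RInt; [exact Cf|lra|lra].
Qed.

Lemma is_RInt_pos_antiderivative (G g : R -> R) (la lb : R) :
  (forall t, 0 < t -> is_derive G t (g t)) -> (forall t, 0 < t -> continuous g t) ->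
  filterlim G (at_right 0) (locally la) ->
  filterlim G (Rbar_locally p_infty) (locally lb) ->
  is_RInt_pos g (lb - la).
Proof.
  intros HG Cg La Lb.
  apply (filterlimi_lim_ext_loc (fun ab : R * R => G (snd ab) - G (fst ab))).
  - eapply filter_imp; [|apply filter_prod_pos].
    intros ab Hab. apply (is_RInt_derive (V := R_CompleteNormedModule) G g);
    intros t Ht; rewrite Rmin_left, Rmax_right in Ht by lra; [apply HG|apply Cg]; lra.
  - apply (filterlim_comp_2 (G := locally lb) (H := locally (opp la))
      (fun ab : R * R => G (snd ab)) (fun ab : R * R => opp (G (fst ab)))
      Rplus).
    + eapply filterlim_comp; [apply filterlim_snd|exact Lb].
    + eapply filterlim_comp; [|apply (filterlim_opp (V := R_NormedModule))].
      eapply filterlim_comp; [apply filterlim_fst|exact La].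
    + apply (filterlim_plus (V := R_NormedModule)).
Qed.

Lemma is_RInt_pos_ext (f g : R -> R) (l : R) :
  (forall t, 0 < t -> f t = g t) -> is_RInt_pos f l -> is_RInt_pos g l.
Proof.
  intros Hfg. apply is_RInt_gen_ext.
  eapply filter_imp; [|apply filter_prod_pos].
  intros ab Hab t Ht. rewrite Rmin_left in Ht by lra. apply Hfg. lra.
Qed.

Lemma is_RInt_pos_norm (f g : R -> R) (lf lg : R) :
  (forall t, 0 < t -> Rabs (f t) <= g t) -> is_RInt_pos f lf -> is_RInt_pos g lg ->
  Rabs lf <= lg.
Proof.
  intros Hfg. apply (RInt_gen_norm (V := R_CompleteNormedModule) f g).
  - eapply filter_imp; [|apply filter_prod_pos]. intros; lra.
  - eapply filter_imp; [|apply filter_prod_pos].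
    intros ab Hab t Ht. apply Hfg. lra.
Qed.

Lemma is_RInt_pos_unique (f : R -> R) (l1 l2 : R) :
  is_RInt_pos f l1 -> is_RInt_pos f l2 -> l1 = l2.
Proof.
  intros H1 H2.
  rewrite <- (is_RInt_gen_unique (V := R_CompleteNormedModule) f l1 H1).
  exact (is_RInt_gen_unique (V := R_CompleteNormedModule) f l2 H2).
Qed.

Lemma is_RInt_pos_lin (f g : R -> R) (c d lf lg : R) :
  is_RInt_pos f lf -> is_RInt_pos g lg ->
  is_RInt_pos (fun t => c * f t + d * g t) (c * lf + d * lg).
Proof.
  intros Hf Hg.
  apply (is_RInt_gen_plus (V := R_NormedModule) (fun t => c * f t) (fun t => d * g t)).
  - now apply (is_RInt_gen_scal (V := R_NormedModule) f c).
  - now apply (is_RInt_gen_scal (V := R_NormedModule) g d).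
Qed.

(** The difference [h = g - f] satisfies [Rabs h <= h], so the norm bound of [h] against itself
    makes its integral nonnegative. *)
Lemma is_RInt_pos_le (f g : R -> R) (lf lg : R) :
  (forall t, 0 < t -> f t <= g t) -> is_RInt_pos f lf -> is_RInt_pos g lg -> lf <= lg.
Proof.
  intros Hfg Hf Hg.
  pose proof (is_RInt_pos_lin g f 1 (-1) lg lf Hg Hf) as H.
  assert (Rabs (1 * lg + -1 * lf) <= 1 * lg + -1 * lf).
  { eapply is_RInt_pos_norm; [|exact H|exact H].
    intros t Ht. simpl. specialize (Hfg t Ht). rewrite Rabs_pos_eq; lra. }
  pose proof (Rabs_pos (1 * lg + -1 * lf)). lra.
Qed.

(** * The Gamma function *)

Definition gamma_kernel (x t : R) : R := Rpower t (x - 1) * exp (- t).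

Lemma Rpower_pos (x y : R) : 0 < Rpower x y.
Proof. apply exp_pos. Qed.

Lemma gamma_kernel_pos (x t : R) : 0 < gamma_kernel x t.
Proof. apply Rmult_lt_0_compat; apply exp_pos. Qed.

Lemma is_derive_Rpower (a t : R) : 0 < t ->
  is_derive (fun t => Rpower t a) t (a * Rpower t (a - 1)).
Proof. intros Ht. apply is_derive_Reals. now apply derivable_pt_lim_power. Qed.

Lemma continuous_Rpower (a t : R) : 0 < t -> continuous (fun t => Rpower t a) t.
Proof.
  intros Ht. apply (ex_derive_continuous (V := R_NormedModule)).
  eexists. now apply is_derive_Rpower.
Qed.

Lemma continuous_exp_opp (t : R) : continuous (fun t => exp (- t)) t.
Proof. apply (ex_derive_continuous (V := R_NormedModule)). auto_derive; auto. Qed.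

Lemma continuous_gamma_kernel (x t : R) : 0 < t -> continuous (gamma_kernel x) t.
Proof.
  intros Ht. apply (continuous_mult (K := R_AbsRing)).
  - now apply continuous_Rpower.
  - apply continuous_exp_opp.
Qed.

Lemma continuous_gamma_kernel_ln (x t : R) : 0 < t ->
  continuous (fun t => gamma_kernel x t * ln t) t.
Proof.
  intros Ht. apply (continuous_mult (K := R_AbsRing)).
  - now apply continuous_gamma_kernel.
  - apply (ex_derive_continuous (V := R_NormedModule)). now auto_derive.
Qed.

Lemma filterlim_Rpower_0 (a : R) : 0 < a ->
  filterlim (fun t => Rpower t a) (at_right 0) (locally 0).
Proof.
  intros Ha. unfold Rpower.
  apply (filterlim_comp _ _ _ (fun t => a * ln t) exp _ (Rbar_locally m_infty)).
  - eapply filterlim_comp; [apply is_lim_ln_0|].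
    replace m_infty with (Rbar_mult a m_infty) at 2.
    apply filterlim_Rbar_mult_l.
    simpl. destruct Rle_dec; [|lra]. destruct Rle_lt_or_eq_dec; [reflexivity|lra].
  - exact is_lim_exp_m.
Qed.

Lemma filterlim_Rpower_p_infty (a : R) : 0 < a ->
  filterlim (fun t => Rpower t a) (Rbar_locally p_infty) (Rbar_locally p_infty).
Proof.
  intros Ha. unfold Rpower.
  apply (filterlim_comp _ _ _ (fun t => a * ln t) exp _ (Rbar_locally p_infty)).
  - eapply filterlim_comp; [apply is_lim_ln_p|].
    replace p_infty with (Rbar_mult a p_infty) at 2.
    apply filterlim_Rbar_mult_l.
    simpl. destruct Rle_dec; [|lra]. destruct Rle_lt_or_eq_dec; [reflexivity|lra].
  - exact is_lim_exp_p.
Qed.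

Lemma ln_le_sub_1 (x : R) : 0 < x -> ln x <= x - 1.
Proof.
  intros Hx. pose proof (exp_ineq1_le (ln x)) as H. rewrite exp_ln in H; lra.
Qed.

Lemma ln_le_tangent (a t : R) : 0 < a -> 0 < t -> ln t <= ln a + (t / a - 1).
Proof.
  intros Ha Ht. pose proof (Rdiv_lt_0_compat _ _ Ht Ha) as Hq.
  pose proof (ln_le_sub_1 (t / a) Hq) as H.
  unfold Rdiv in H at 1. rewrite ln_mult in H; [|exact Ht|now apply Rinv_0_lt_compat].
  rewrite ln_Rinv in H; lra.
Qed.

(** The right side is the maximum of the left, attained at [t = y]; the tangent of [ln] at [y]
    proves it. *)
Lemma Rpower_mult_exp_opp_le (y t : R) : 0 < y -> 0 < t ->
  Rpower t y * exp (- t) <= exp (y * ln y - y).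
Proof.
  intros Hy Ht. unfold Rpower. rewrite <- exp_plus.
  pose proof (ln_le_tangent y t Hy Ht) as H.
  apply (Rmult_le_compat_l y) in H; [|lra].
  replace (y * (ln y + (t / y - 1))) with (y * ln y + t - y) in H by (field; lra).
  destruct (Rle_lt_or_eq_dec (y * ln t + - t) (y * ln y - y)) as [L|L]; [lra| |].
  - left. now apply exp_increasing.
  - rewrite L. apply Rle_refl.
Qed.

(* The majorant is a multiple of the derivative of [- / (1 + t ^ x)], which is
   bounded on the half-line. *)
Lemma ex_RInt_gamma_kernel (x : R) : 0 < x ->
  exists l, is_RInt_pos (gamma_kernel x) l.
Proof.
  intros Hx.
  set (G := fun t => - / (1 + Rpower t x)).
  set (g := fun t => x * Rpower t (x - 1) / (1 + Rpower t x) ^ 2).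
  (* Expanding [(1 + t ^ x) ^ 2 * exp (- t)] gives three terms, each replaced by an upper bound; the
     division by [x] cancels the factor [x] of [g]. *)
  set (C := (1 + 2 * exp (x * ln x - x) + exp (2 * x * ln (2 * x) - 2 * x)) / x).
  assert (Dg : forall t, 0 < t -> is_derive G t (g t)).
  { intros t Ht. unfold G, g. pose proof (Rpower_pos t x).
    evar_last.
    - apply (is_derive_opp (V := R_NormedModule)). apply is_derive_inv; [|lra].
      apply (is_derive_plus (V := R_NormedModule)).
      + apply (is_derive_const (V := R_NormedModule)).
      + now apply is_derive_Rpower.
    - unfold opp, plus, zero; simpl. field. lra. }
  assert (Cg : forall t, 0 < t -> continuous g t).
  { intros t Ht. unfold g. pose proof (Rpower_pos t x).
    apply (ex_derive_continuous (V := R_NormedModule)).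
    apply (ex_derive_div (fun t => x * Rpower t (x - 1)) (fun t => (1 + Rpower t x) ^ 2)).
    - apply ex_derive_mult; [apply ex_derive_const|].
      eexists. now apply is_derive_Rpower.
    - apply ex_derive_pow. apply (ex_derive_plus (V := R_NormedModule)).
      + apply ex_derive_const.
      + eexists. now apply is_derive_Rpower.
    - apply Rgt_not_eq. apply pow_lt. lra. }
  assert (Hg : is_RInt_pos g (0 - (- / (1 + 0)))).
  { apply is_RInt_pos_antiderivative with G; try assumption; unfold G.
    - apply (filterlim_comp _ _ _ (fun t => Rpower t x) (fun u => - / (1 + u)) _ (locally 0)).
      + now apply filterlim_Rpower_0.
      + assert (K : continuous (fun u => - / (1 + u)) 0); [|exact K].
        apply (ex_derive_continuous (V := R_NormedModule)). auto_derive. lra.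
    - apply (filterlim_comp _ _ _ (fun t => / (1 + Rpower t x)) Ropp _ (locally 0)).
      + apply (filterlim_comp _ _ _ (fun t => 1 + Rpower t x) Rinv _ (Rbar_locally p_infty)).
        * apply (filterlim_comp _ _ _ (fun t => Rpower t x) (Rplus 1) _ (Rbar_locally p_infty)).
          now apply filterlim_Rpower_p_infty.
          intros P [M HM]. exists (M - 1). intros u Hu. apply HM. lra.
        * apply (filterlim_Rbar_inv p_infty). discriminate.
      + rewrite <- Ropp_0 at 2. apply (filterlim_opp (V := R_NormedModule)). }
  destruct (dominated_ex_RInt_pos (gamma_kernel x) (fun t => C * g t) (C * (0 - - / (1 + 0))))
    as [l Hl].
  - apply continuous_gamma_kernel.
  - intros t Ht. apply (continuous_scal_r (V := R_NormedModule) C). now apply Cg.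
  - intros t Ht. rewrite Rabs_pos_eq by (left; apply gamma_kernel_pos).
    unfold C, g, gamma_kernel.
    pose proof (Rpower_pos t x) as P0. pose proof (Rpower_pos t (x - 1)) as P1.
    replace (_ / x * _) with (Rpower t (x - 1) *
      ((1 + 2 * exp (x * ln x - x) + exp (2 * x * ln (2 * x) - 2 * x)) /
        (1 + Rpower t x) ^ 2)) by (field; lra).
    apply Rmult_le_compat_l; [lra|].
    apply Rle_div_r; [apply pow_lt; lra|].
    pose proof (Rpower_mult_exp_opp_le x t Hx Ht) as E1.
    pose proof (Rpower_mult_exp_opp_le (2 * x) t ltac:(lra) Ht) as E2.
    replace (2 * x) with (x + x) in E2 at 1 by ring. rewrite Rpower_plus in E2.
    assert (exp (- t) <= 1) by (rewrite <- exp_0; left; apply exp_increasing; lra).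
    nra.
  - exact (is_RInt_gen_scal (V := R_NormedModule) g C _ Hg).
  - now exists l.
Qed.

Lemma is_RInt_gamma_kernel (x : R) : 0 < x -> is_RInt_pos (gamma_kernel x) (Gamma x).
Proof.
  intros Hx. destruct (ex_RInt_gamma_kernel x Hx) as [l Hl].
  replace (Gamma x) with l; [exact Hl|]. symmetry.
  exact (is_RInt_gen_unique (V := R_CompleteNormedModule) _ l Hl).
Qed.

Lemma gamma_kernel_shift (x a t : R) :
  gamma_kernel (x + a) t = gamma_kernel x t * Rpower t a.
Proof.
  unfold gamma_kernel. replace (x + a - 1) with ((x - 1) + a) by ring.
  rewrite Rpower_plus. ring.
Qed.

Lemma gamma_kernel_mult_id (x t : R) : 0 < t ->
  gamma_kernel x t * t = gamma_kernel (x + 1) t.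
Proof. intros Ht. rewrite gamma_kernel_shift, Rpower_1; auto. Qed.

(** Integration by parts: the combined integrand is the derivative of [t ^ x * exp (- t)], which
    vanishes at both ends. *)
Lemma Gamma_plus_1 (x : R) : 0 < x -> Gamma (x + 1) = x * Gamma x.
Proof.
  intros Hx.
  assert (H : is_RInt_pos (fun t => x * gamma_kernel x t + -1 * gamma_kernel (x + 1) t)
                (0 - 0)).
  { apply is_RInt_pos_antiderivative with (fun t => Rpower t x * exp (- t)).
    - intros t Ht. evar_last.
      + apply (is_derive_mult (K := R_AbsRing)); [now apply is_derive_Rpower| |].
        * auto_derive; [exact I|reflexivity].
        * intros; apply Rmult_comm.
      + unfold gamma_kernel, plus, mult; simpl.
        replace (x + 1 - 1) with x by ring. ring.
    - intros t Ht. apply (continuous_plus (V := R_NormedModule));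
      apply (continuous_scal_r (V := R_NormedModule)); now apply continuous_gamma_kernel.
    - replace 0 with (mult 0 (exp (- 0))) at 2 by apply Rmult_0_l.
      eapply (filterlim_comp_2 (G := locally 0) (H := locally (exp (-0)))).
      + now apply filterlim_Rpower_0.
      + eapply filterlim_filter_le_1; [|apply continuous_exp_opp].
        apply filter_le_within.
      + apply (filterlim_mult (K := R_AbsRing)).
    (* Bounding [t ^ (x + 1) * exp (- t)] by its maximum leaves a multiple of [/ t], which gives the
       decay at infinity. *)
    - apply (filterlim_le_le (fun _ => 0) _
               (fun t => exp ((x + 1) * ln (x + 1) - (x + 1)) * / t) 0).
      + exists 0. intros t Ht. assert (0 < t) as Ht0 by exact Ht. pose proof (Rpower_pos t x). pose proof (exp_pos (- t)).
        split; [nra|].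
        pose proof (Rpower_mult_exp_opp_le (x + 1) t ltac:(lra) Ht) as E.
        rewrite Rpower_plus, Rpower_1 in E by lra.
        apply (Rle_div_r _ _ t); [assumption|].
        eapply Rle_trans; [|exact E]. right. ring.
      + apply filterlim_const.
      + rewrite <- (Rmult_0_r (exp ((x + 1) * ln (x + 1) - (x + 1)))).
        eapply filterlim_comp; [|apply (filterlim_Rbar_mult_l _ (Finite 0))].
        apply (filterlim_Rbar_inv p_infty). discriminate. }
  pose proof (is_RInt_pos_lin _ _ x (-1) _ _ (is_RInt_gamma_kernel x Hx)
    (is_RInt_gamma_kernel (x + 1) ltac:(lra))) as H'.
  pose proof (is_RInt_pos_unique _ _ _ H H'). lra.
Qed.

Lemma Gamma_1 : Gamma 1 = 1.
Proof.
  apply (is_RInt_pos_unique (gamma_kernel 1)); [apply is_RInt_gamma_kernel; lra|].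
  apply is_RInt_pos_ext with (fun t => exp (- t)).
  - intros t Ht. unfold gamma_kernel. rewrite Rminus_diag, Rpower_O by exact Ht. ring.
  - replace 1 with (0 - - exp (- 0)) by (rewrite Ropp_0, exp_0; ring).
    apply is_RInt_pos_antiderivative with (fun t => - exp (- t)).
    + intros t Ht. auto_derive; [exact I|ring].
    + intros. apply continuous_exp_opp.
    + eapply filterlim_filter_le_1; [apply filter_le_within|].
      assert (K : continuous (fun t => - exp (- t)) 0); [|exact K].
      apply (ex_derive_continuous (V := R_NormedModule)). now auto_derive.
    + rewrite <- Ropp_0.
      eapply filterlim_comp; [|apply (filterlim_opp (V := R_NormedModule))].
      eapply filterlim_comp; [apply (filterlim_Rbar_opp p_infty)|exact is_lim_exp_m].
Qed.

(** * Differentiability of Gamma and bounds for digamma *)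

Definition Gamma_deriv (x : R) : R :=
  RInt_gen (fun t => gamma_kernel x t * ln t) (at_right 0) (Rbar_locally p_infty).

Lemma exp_Rabs_ln_le (d t : R) : 0 <= d ->
  exp (d * Rabs (ln t)) <= Rpower t d + Rpower t (- d).
Proof.
  intros Hd. unfold Rpower.
  pose proof (exp_pos (d * ln t)). pose proof (exp_pos (- d * ln t)).
  destruct (Rle_lt_dec 0 (ln t)).
  - rewrite Rabs_pos_eq by assumption. lra.
  - rewrite Rabs_left by assumption. replace (d * - ln t) with (- d * ln t) by ring. lra.
Qed.

(** Powers of [Rabs (ln t)] are dominated by [exp (d * Rabs (ln t))], and this factor is absorbed by
    moving the parameter of the kernel by [d] both ways. *)
Lemma gamma_kernel_exp_Rabs_ln_le (x d t : R) : 0 <= d ->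
  gamma_kernel x t * exp (d * Rabs (ln t))
  <= 1 * gamma_kernel (x + d) t + 1 * gamma_kernel (x + - d) t.
Proof.
  intros Hd. rewrite !gamma_kernel_shift.
  pose proof (gamma_kernel_pos x t). pose proof (exp_Rabs_ln_le d t Hd).
  apply (Rmult_le_compat_l (gamma_kernel x t)) in H0; lra.
Qed.

Lemma is_RInt_gamma_kernel_ln (x : R) : 0 < x ->
  is_RInt_pos (fun t => gamma_kernel x t * ln t) (Gamma_deriv x).
Proof.
  intros Hx.
  (* Keeps [x - d] positive, so that both majorizing kernels are integrable. *)
  set (d := x / 2).
  pose proof (is_RInt_pos_lin _ _ 1 1 _ _ (is_RInt_gamma_kernel (x + d) ltac:(unfold d; lra))
    (is_RInt_gamma_kernel (x + - d) ltac:(unfold d; lra))) as HD.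
  pose proof (is_RInt_gen_scal (V := R_NormedModule) _ (/ d) _ HD) as HD'.
  destruct (dominated_ex_RInt_pos (fun t => gamma_kernel x t * ln t)
    (fun t => / d * (1 * gamma_kernel (x + d) t + 1 * gamma_kernel (x + - d) t))
    (scal (/ d) (1 * Gamma (x + d) + 1 * Gamma (x + - d)))) as [l Hl];
    [| | |exact HD'|].
  - intros t Ht. now apply continuous_gamma_kernel_ln.
  - intros t Ht.
    assert (K : forall c y, continuous (fun t => c * gamma_kernel y t) t).
    { intros c y. apply (continuous_scal_r (V := R_NormedModule) c).
      now apply continuous_gamma_kernel. }
    apply (continuous_scal_r (V := R_NormedModule) (/ d)).
    apply (continuous_plus (V := R_NormedModule)); apply K.
  - intros t Ht.
    assert (Hd : 0 < d) by (unfold d; lra).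
    apply (Rmult_le_reg_l d); [exact Hd|].
    rewrite <- Rmult_assoc, Rinv_r, Rmult_1_l by lra.
    eapply Rle_trans; [|apply gamma_kernel_exp_Rabs_ln_le; lra].
    rewrite Rabs_mult, (Rabs_pos_eq (gamma_kernel x t)) by (left; apply gamma_kernel_pos).
    pose proof (exp_ineq1_le (d * Rabs (ln t))). pose proof (gamma_kernel_pos x t). nra.
  - replace (Gamma_deriv x) with l; [exact Hl|]. symmetry.
    exact (is_RInt_gen_unique (V := R_CompleteNormedModule) _ l Hl).
Qed.

(** Applied at [u] and [- u], [1 + v <= exp v] gives [u <= exp u - 1 <= u * exp u]. The upper bound
    yields [exp u - 1 - u <= u * (exp u - 1)]; then the upper bound is used again for [u >= 0], the
    lower one for [u < 0]. *)
Lemma Rabs_exp_taylor1_le (u : R) : Rabs (exp u - 1 - u) <= u ^ 2 * exp (Rabs u).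
Proof.
  pose proof (exp_ineq1_le u) as H1. pose proof (exp_ineq1_le (- u)) as H2.
  pose proof (exp_pos u) as P.
  assert (E : exp (- u) * exp u = 1) by (rewrite <- exp_plus, Rplus_opp_l; apply exp_0).
  assert (H3 : (1 - u) * exp u <= 1).
  { rewrite <- E. apply Rmult_le_compat_r; lra. }
  rewrite Rabs_pos_eq by lra.
  apply Rle_trans with (u * (exp u - 1)); [lra|].
  destruct (Rle_lt_dec 0 u).
  - rewrite Rabs_pos_eq by assumption. nra.
  - rewrite Rabs_left by assumption. pose proof (exp_ineq1_le (- u)).
    assert (u * (exp u - 1) <= u * u) by nra. nra.
Qed.

Lemma pow2_le_exp (y : R) : 0 <= y -> y ^ 2 <= 4 * exp y.
Proof.
  intros Hy. pose proof (exp_ineq1_le (y / 2)).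
  replace y with (y / 2 + y / 2) at 2 by field. rewrite exp_plus. nra.
Qed.

(** With [y = d * Rabs (ln t)], the Taylor remainder is at most [h ^ 2 / d ^ 2 * y ^ 2 * exp y].
    Since [y ^ 2 <= 4 * exp y], the exponential is squared, whence the shift [2 * d]. The
    coefficients [1] and [-1] match the shape produced by [is_RInt_pos_lin]. *)
Lemma gamma_kernel_taylor (x d h t : R) : 0 < d -> Rabs h <= d ->
  Rabs (1 * (1 * gamma_kernel (x + h) t + -1 * gamma_kernel x t)
        + - h * (gamma_kernel x t * ln t))
  <= 4 * h ^ 2 / d ^ 2 * (1 * gamma_kernel (x + 2 * d) t + 1 * gamma_kernel (x + - (2 * d)) t).
Proof.
  intros Hd Hh.
  eapply Rle_trans.
  2:{ apply Rmult_le_compat_l; [|apply gamma_kernel_exp_Rabs_ln_le; lra].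
      apply Rcomplements.Rdiv_le_0_compat; [|apply pow_lt; lra]. nra. }
  rewrite gamma_kernel_shift.
  replace (1 * _ + _) with (gamma_kernel x t * (Rpower t h - 1 - h * ln t)) by ring.
  pose proof (gamma_kernel_pos x t).
  rewrite Rabs_mult, (Rabs_pos_eq (gamma_kernel x t)) by lra.
  replace (_ / _ * (_ * _)) with
    (gamma_kernel x t * (4 * h ^ 2 / d ^ 2 * exp (2 * d * Rabs (ln t)))) by ring.
  apply Rmult_le_compat_l; [lra|].
  unfold Rpower. eapply Rle_trans; [apply Rabs_exp_taylor1_le|].
  set (y := d * Rabs (ln t)).
  assert (Hy : 0 <= y) by (apply Rmult_le_pos; [lra|apply Rabs_pos]).
  replace (2 * d * Rabs (ln t)) with (y + y) by (unfold y; ring).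
  rewrite exp_plus.
  assert (E : exp (Rabs (h * ln t)) <= exp y).
  { assert (L : Rabs (h * ln t) <= y).
    { rewrite Rabs_mult. apply Rmult_le_compat_r; [apply Rabs_pos|exact Hh]. }
    destruct L as [L|L]; [left; now apply exp_increasing|right; now rewrite L]. }
  assert (S : (h * ln t) ^ 2 <= 4 * h ^ 2 / d ^ 2 * exp y).
  { replace ((h * ln t) ^ 2) with (h ^ 2 / d ^ 2 * y ^ 2).
    - replace (4 * h ^ 2 / d ^ 2 * exp y) with (h ^ 2 / d ^ 2 * (4 * exp y)) by (field; lra).
      apply Rmult_le_compat_l; [|now apply pow2_le_exp].
      apply Rcomplements.Rdiv_le_0_compat; [nra|apply pow_lt; lra].
    - unfold y. rewrite !Rpow_mult_distr, (pow2_abs (ln t)). field. lra. }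
  rewrite <- Rmult_assoc.
  apply Rmult_le_compat; [nra|left; apply exp_pos|exact S|exact E].
Qed.

Lemma is_derive_quadratic (f : R -> R) (x l K d : R) : 0 < d ->
  (forall h, Rabs h <= d -> Rabs (f (x + h) - f x - h * l) <= K * h ^ 2) ->
  is_derive f x l.
Proof.
  intros Hd H. apply is_derive_Reals. intros eps Heps.
  pose proof (Rabs_pos K) as HK.
  (* [Rabs K + 1] is a positive denominator whatever the sign of [K]. *)
  assert (Hm : 0 < Rmin d (eps / (Rabs K + 1))).
  { apply Rmin_glb_lt; [exact Hd|]. apply Rdiv_lt_0_compat; lra. }
  exists (mkposreal _ Hm). intros h Hh0 Hh. simpl in Hh.
  pose proof (Rmin_l d (eps / (Rabs K + 1))). pose proof (Rmin_r d (eps / (Rabs K + 1))).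
  replace ((f (x + h) - f x) / h - l) with ((f (x + h) - f x - h * l) / h) by (now field).
  rewrite Rabs_div by exact Hh0.
  pose proof (Rabs_pos_lt h Hh0) as Hp.
  apply Rlt_div_l; [exact Hp|].
  eapply Rle_lt_trans; [apply H; lra|].
  rewrite <- pow2_abs.
  assert (Rabs h * (Rabs K + 1) < eps).
  { apply Rlt_div_r; lra. }
  pose proof (Rle_abs K).
  apply Rle_lt_trans with (Rabs K * Rabs h ^ 2); [apply Rmult_le_compat_r; nra|].
  nra.
Qed.

Lemma is_derive_Gamma (x : R) : 0 < x -> is_derive Gamma x (Gamma_deriv x).
Proof.
  (* A quarter keeps both [x - 2 * d] and [x + h] positive. *)
  intros Hx. set (d := x / 4). assert (Hd : 0 < d) by (unfold d; lra).
  apply is_derive_quadratic with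
    (4 / d ^ 2 * (Gamma (x + 2 * d) + Gamma (x + - (2 * d)))) d; [exact Hd|].
  assert (Hp : 0 < x + 2 * d) by (unfold d; lra).
  assert (Hm : 0 < x + - (2 * d)) by (unfold d; lra).
  intros h Hh.
  assert (Hxh : 0 < x + h) by (apply Rabs_le_between in Hh; unfold d in Hh; lra).
  pose proof (is_RInt_pos_lin _ _ 1 (- h) _ _
    (is_RInt_pos_lin _ _ 1 (-1) _ _ (is_RInt_gamma_kernel _ Hxh) (is_RInt_gamma_kernel x Hx))
    (is_RInt_gamma_kernel_ln x Hx)) as L.
  pose proof (is_RInt_gen_scal (V := R_NormedModule) _ (4 * h ^ 2 / d ^ 2) _
    (is_RInt_pos_lin _ _ 1 1 _ _
      (is_RInt_gamma_kernel (x + 2 * d) Hp) (is_RInt_gamma_kernel (x + - (2 * d)) Hm))) as D.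
  pose proof (is_RInt_pos_norm _ _ _ _
    (fun t Ht => gamma_kernel_taylor x d h t Hd Hh) L D) as E.
  unfold scal in E; simpl in E; unfold mult in E; simpl in E.
  eapply Rle_trans; [|eapply Rle_trans; [exact E|]]; right; [f_equal; ring|field; lra].
Qed.

(* Jensen's inequality for [exp] against the probability density [exp (- t)]:
   the tangent of [exp] is taken at the mean of [(x - 1) * ln t]. *)
Lemma Gamma_pos (x : R) : 0 < x -> 0 < Gamma x.
Proof.
  intros Hx. set (m := (x - 1) * Gamma_deriv 1).
  apply Rlt_le_trans with (exp m); [apply exp_pos|].
  pose proof (is_RInt_pos_lin _ _ (exp m * (1 - m)) (exp m * (x - 1)) _ _
    (is_RInt_gamma_kernel 1 Rlt_0_1) (is_RInt_gamma_kernel_ln 1 Rlt_0_1)) as L.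
  rewrite Gamma_1 in L.
  replace (exp m) with (exp m * (1 - m) * 1 + exp m * (x - 1) * Gamma_deriv 1)
    by (unfold m; ring).
  eapply is_RInt_pos_le; [|exact L|now apply is_RInt_gamma_kernel].
  intros t Ht. simpl.
  replace (gamma_kernel x t) with (gamma_kernel 1 t * Rpower t (x - 1))
    by (rewrite <- gamma_kernel_shift; f_equal; ring).
  pose proof (gamma_kernel_pos 1 t).
  replace (_ + _) with (gamma_kernel 1 t * (exp m * (1 + ((x - 1) * ln t - m)))) by ring.
  apply Rmult_le_compat_l; [lra|].
  unfold Rpower.
  replace ((x - 1) * ln t) with (m + ((x - 1) * ln t - m)) at 2 by ring.
  rewrite exp_plus. apply Rmult_le_compat_l; [left; apply exp_pos|apply exp_ineq1_le].
Qed.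

Lemma digamma_eq (x : R) : 0 < x -> digamma x = Gamma_deriv x / Gamma x.
Proof.
  intros Hx. unfold digamma. now rewrite (is_derive_unique _ _ _ (is_derive_Gamma x Hx)).
Qed.

Lemma digamma_plus_1 (x : R) : 0 < x -> digamma (x + 1) = digamma x + / x.
Proof.
  intros Hx. rewrite !digamma_eq by lra.
  assert (E : Gamma_deriv (x + 1) = Gamma x + x * Gamma_deriv x).
  { assert (D1 : is_derive (fun y => Gamma (y + 1)) x (Gamma_deriv (x + 1))).
    { evar_last.
      - apply (is_derive_comp (V := R_NormedModule)).
        + apply is_derive_Gamma. lra.
        + auto_derive; [exact I|reflexivity].
      - apply Rmult_1_l. }
    assert (D2 : is_derive (fun y => y * Gamma y) x (Gamma x + x * Gamma_deriv x)).
    { evar_last.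
      - apply (is_derive_mult (K := R_AbsRing)).
        + apply (is_derive_id (K := R_AbsRing)).
        + now apply is_derive_Gamma.
        + intros; apply Rmult_comm.
      - unfold plus, mult, one; simpl. ring. }
    (* The functional equation is known for positive arguments only, so the two functions are
       compared on the ball of radius [x]. *)
    apply (is_derive_ext_loc _ (fun y => y * Gamma y)) in D1.
    - rewrite <- (is_derive_unique _ _ _ D1). now apply is_derive_unique.
    - exists (mkposreal x Hx). intros y Hy. apply Gamma_plus_1.
      apply Rabs_lt_between in Hy. unfold minus, plus, opp in Hy; simpl in Hy. lra. }
  rewrite E, (Gamma_plus_1 x Hx). pose proof (Gamma_pos x Hx). field. lra.
Qed.

(** psi(x) is the mean of [ln t] for the density proportional to [gamma_kernel x], whose mean is
    [x]; the tangent of [ln] is taken there. *)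
Lemma digamma_le_ln (x : R) : 0 < x -> digamma x <= ln x.
Proof.
  intros Hx. rewrite digamma_eq by exact Hx. pose proof (Gamma_pos x Hx) as P.
  apply Rle_div_l; [exact P|].
  pose proof (is_RInt_pos_lin _ _ (ln x - 1) (/ x) _ _ (is_RInt_gamma_kernel x Hx)
    (is_RInt_gamma_kernel (x + 1) ltac:(lra))) as U.
  replace (ln x * Gamma x) with ((ln x - 1) * Gamma x + / x * Gamma (x + 1))
    by (rewrite Gamma_plus_1 by exact Hx; field; lra).
  eapply is_RInt_pos_le; [|now apply is_RInt_gamma_kernel_ln|exact U].
  intros t Ht. simpl. rewrite <- gamma_kernel_mult_id by exact Ht.
  pose proof (gamma_kernel_pos x t). pose proof (ln_le_tangent x t Hx Ht) as L.
  apply (Rmult_le_compat_l (gamma_kernel x t)) in L; [|lra].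
  eapply Rle_trans; [exact L|]. right. field. lra.
Qed.

(** For the density of parameter [x + 1] the mean of [/ t] is [/ x], so the tangent of [ln] in the
    variable [/ t] at [/ x] bounds [- ln t] from above. *)
Lemma ln_le_digamma_plus_1 (x : R) : 0 < x -> ln x <= digamma (x + 1).
Proof.
  intros Hx. rewrite digamma_eq by lra. pose proof (Gamma_pos (x + 1) ltac:(lra)) as P.
  apply Rle_div_r; [exact P|].
  pose proof (is_RInt_pos_lin _ _ (ln x + 1) (- x) _ _
    (is_RInt_gamma_kernel (x + 1) ltac:(lra)) (is_RInt_gamma_kernel x Hx)) as U.
  replace (ln x * Gamma (x + 1)) with ((ln x + 1) * Gamma (x + 1) + - x * Gamma x)
    by (rewrite Gamma_plus_1 by exact Hx; ring).
  eapply is_RInt_pos_le; [|exact U|apply is_RInt_gamma_kernel_ln; lra].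
  intros t Ht. simpl. rewrite <- gamma_kernel_mult_id by exact Ht.
  pose proof (gamma_kernel_pos x t).
  pose proof (ln_le_tangent (/ x) (/ t) (Rinv_0_lt_compat _ Hx) (Rinv_0_lt_compat _ Ht)) as L.
  rewrite !ln_Rinv in L by assumption.
  replace (/ t / / x) with (x / t) in L by (field; lra).
  apply (Rmult_le_compat_l (gamma_kernel x t * t)) in L; [|nra].
  replace (gamma_kernel x t * t * (- ln x + (x / t - 1))) with
    (gamma_kernel x t * (x - t - t * ln x)) in L by (field; lra).
  nra.
Qed.

(** * Asymptotics of digamma and the Fourier series of ln (2 sin (s / 2)) *)

(* Fixing the carrier to [R] lets [ring] and [field] see the sums as real numbers. *)
Definition Rsum (a : nat -> R) (m : nat) : R := sum_n_m a 1 m.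

Lemma Rsum_0 (a : nat -> R) : Rsum a 0 = 0.
Proof. apply (sum_n_m_zero (G := R_AbelianMonoid)). lia. Qed.

Lemma Rsum_succ (a : nat -> R) (m : nat) : Rsum a (S m) = Rsum a m + a (S m).
Proof. apply (sum_n_Sm (G := R_AbelianMonoid)). lia. Qed.

Lemma Rsum_scal (c : R) (a : nat -> R) (m : nat) :
  Rsum (fun k => c * a k) m = c * Rsum a m.
Proof. apply (sum_n_m_mult_l (K := R_Ring)). Qed.

Lemma Rsum_plus (a b : nat -> R) (m : nat) :
  Rsum (fun k => a k + b k) m = Rsum a m + Rsum b m.
Proof. apply (sum_n_m_plus (G := R_AbelianMonoid)). Qed.

Lemma Rsum_ext (a b : nat -> R) (m : nat) :
  (forall k, (1 <= k <= m)%nat -> a k = b k) -> Rsum a m = Rsum b m.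
Proof. apply (sum_n_m_ext_loc (G := R_AbelianMonoid)). Qed.

Lemma Rsum_offset (a : nat -> R) (p n : nat) :
  Rsum a (p + n) = Rsum a p + Rsum (fun k => a (p + k)%nat) n.
Proof.
  induction n as [|n IH].
  - rewrite Nat.add_0_r, Rsum_0. ring.
  - rewrite Nat.add_succ_r, !Rsum_succ, IH, Nat.add_succ_r. ring.
Qed.

Lemma Rsum_exchange (u : nat -> nat -> R) (n m : nat) :
  Rsum (fun i => Rsum (u i) m) n
  = Rsum (fun j => Rsum (fun i => u i j) n) m.
Proof.
  induction n as [|n IH].
  - rewrite Rsum_0.
    (* Writing zero as [0 * 0] lets [Rsum_scal] evaluate a sum of zeros. *)
    rewrite (Rsum_ext _ (fun _ => 0 * 0)), (Rsum_scal 0 (fun _ => 0)).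
    + ring.
    + intros k _. rewrite Rsum_0. ring.
  - rewrite Rsum_succ, IH, <- Rsum_plus.
    apply Rsum_ext. intros k _. now rewrite Rsum_succ.
Qed.

Lemma is_lim_seq_Rsum (u : nat -> nat -> R) (l : nat -> R) (n : nat) :
  (forall k, (1 <= k <= n)%nat -> is_lim_seq (fun N => u N k) (l k)) ->
  is_lim_seq (fun N => Rsum (u N) n) (Rsum l n).
Proof.
  induction n as [|n IH]; intros H.
  - rewrite Rsum_0.
    apply is_lim_seq_ext with (fun _ => 0); [|apply is_lim_seq_const].
    intros N. now rewrite Rsum_0.
  - rewrite Rsum_succ.
    apply is_lim_seq_ext with (fun N => Rsum (u N) n + u N (S n)).
    + intros N. now rewrite Rsum_succ.
    + apply is_lim_seq_plus'; [apply IH; intros; apply H; lia|apply H; lia].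
Qed.

Lemma is_lim_seq_const_div_INR (c : R) : is_lim_seq (fun N => c / INR N) 0.
Proof.
  unfold Rdiv. rewrite <- (Rmult_0_r c).
  apply (is_lim_seq_scal_l (fun N => / INR N) c 0).
  apply (is_lim_seq_inv INR p_infty); [apply is_lim_seq_INR|discriminate].
Qed.

Lemma is_lim_seq_double (u : nat -> R) (l : Rbar) :
  is_lim_seq u l -> is_lim_seq (fun N => u (2 * N)%nat) l.
Proof.
  intros H. apply (is_lim_seq_subseq u l (fun N => (2 * N)%nat)); [|exact H].
  apply eventually_subseq. intros. lia.
Qed.

(** Above, psi(x + N) <= ln(x + N) <= ln N + x / N. Below, ln N <= psi(x + N + 1) = psi(x + N) + 1 /
    (x + N), which costs at most 1 / N. *)
Lemma digamma_plus_INR_minus_ln_lim (x : R) : 0 < x ->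
  is_lim_seq (fun N => digamma (x + INR N) - ln (INR N)) 0.
Proof.
  intros Hx.
  apply is_lim_seq_le_le_loc with (fun N => -1 / INR N) (fun N => x / INR N);
    [|apply is_lim_seq_const_div_INR|apply is_lim_seq_const_div_INR].
  exists 1%nat. intros N HN.
  assert (HP : 0 < INR N) by (apply lt_0_INR; lia).
  pose proof (digamma_le_ln (x + INR N) ltac:(lra)) as U.
  pose proof (ln_le_tangent (INR N) (x + INR N) HP ltac:(lra)) as T.
  pose proof (ln_le_digamma_plus_1 (x + INR N) ltac:(lra)) as L.
  rewrite digamma_plus_1 in L by lra.
  pose proof (ln_le (INR N) (x + INR N) HP ltac:(lra)).
  pose proof (Rinv_le_contravar (INR N) (x + INR N) HP ltac:(lra)).
  replace ((x + INR N) / INR N - 1) with (x / INR N) in T by (field; lra).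
  unfold Rdiv in *. lra.
Qed.

Lemma digamma_1_plus_INR (N : nat) :
  digamma (1 + INR N) = digamma 1 + Rsum (fun k => / INR k) N.
Proof.
  induction N as [|N IH].
  - rewrite Rsum_0. simpl. now rewrite !Rplus_0_r.
  - rewrite Rsum_succ, <- Rplus_assoc, <- IH.
    pose proof (pos_INR N).
    replace (1 + INR (S N)) with (1 + INR N + 1) by (rewrite S_INR; ring).
    rewrite digamma_plus_1 by lra. do 2 f_equal. rewrite S_INR. ring.
Qed.

Lemma euler_gamma_eq : euler_gamma = - digamma 1.
Proof.
  unfold euler_gamma.
  rewrite (is_lim_seq_unique _ (Finite (- digamma 1))); [reflexivity|].
  apply is_lim_seq_ext with (fun N => (digamma (1 + INR N) - ln (INR N)) + - digamma 1).
  - intros N. change (sum_n_m _ 1 N) with (Rsum (fun k => / INR k) N).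
    rewrite digamma_1_plus_INR. ring.
  - replace (Finite (- digamma 1)) with (Finite (0 + - digamma 1)) by (f_equal; ring).
    apply is_lim_seq_plus'; [|apply is_lim_seq_const].
    apply digamma_plus_INR_minus_ln_lim. lra.
Qed.

(** * Partial sums of the cosine series *)

Definition cos_log_partial (M : nat) (s : R) : R :=
  Rsum (fun m => cos (INR m * s) / INR m) M.

Lemma cos_INR_mult_PI (m : nat) : cos (INR m * PI) = (-1) ^ m.
Proof.
  induction m as [|m IH].
  - simpl. now rewrite Rmult_0_l, cos_0.
  - rewrite S_INR, Rmult_plus_distr_r, Rmult_1_l, neg_cos, IH. simpl. ring.
Qed.

(** The alternating sum of length [2 * N] is [H N - H (2 * N)] with [H] the harmonic numbers, and
    these are psi(1 + N) - psi(1). The limit is that of ln N - ln(2 N). *)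
Lemma cos_log_partial_PI_lim :
  is_lim_seq (fun N => cos_log_partial (2 * N) PI) (- ln 2).
Proof.
  set (H := fun N => Rsum (fun k => / INR k) N).
  assert (E : forall N, cos_log_partial (2 * N) PI = H N - H (2 * N)%nat).
  { unfold cos_log_partial, H. induction N as [|N IH].
    - rewrite !Rsum_0. ring.
    - replace (2 * S N)%nat with (S (S (2 * N))) by lia.
      rewrite !Rsum_succ, IH, !cos_INR_mult_PI.
      rewrite <- !tech_pow_Rmult, pow_1_even.
      pose proof (pos_INR N). rewrite !S_INR, mult_INR. simpl INR. field. lra. }
  apply is_lim_seq_ext_loc with
    (fun N => (digamma (1 + INR N) - ln (INR N))
      - (digamma (1 + INR (2 * N)) - ln (INR (2 * N))) + - ln 2).
  - exists 1%nat. intros N HN. rewrite E, !digamma_1_plus_INR. unfold H.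
    replace (INR (2 * N)) with (2 * INR N) by (rewrite mult_INR; simpl; ring).
    rewrite ln_mult; [ring| |].
    + lra.
    + apply lt_0_INR; lia.
  - replace (Finite (- ln 2)) with (Finite (0 - 0 + - ln 2)) by (f_equal; ring).
    pose proof (digamma_plus_INR_minus_ln_lim 1 Rlt_0_1) as L.
    apply is_lim_seq_plus'; [|apply is_lim_seq_const].
    apply is_lim_seq_minus'; [exact L|].
    exact (is_lim_seq_double _ _ L).
Qed.

(** Each product [2 * sin (s / 2) * sin (m * s)] is a difference of cosines at consecutive
    half-integer multiples of [s], so the sum telescopes. *)
Lemma sum_sin_mult (M : nat) (s : R) :
  2 * sin (s / 2) * Rsum (fun m => sin (INR m * s)) M
  = cos (s / 2) - cos ((INR M + 1 / 2) * s).
Proof.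
  induction M as [|M IH].
  - rewrite Rsum_0. simpl INR.
    replace ((0 + 1 / 2) * s) with (s / 2) by field. ring.
  - rewrite Rsum_succ, Rmult_plus_distr_l, IH.
    replace ((INR M + 1 / 2) * s) with (INR (S M) * s - s / 2) by (rewrite S_INR; field).
    replace ((INR (S M) + 1 / 2) * s) with (INR (S M) * s + s / 2) by field.
    rewrite cos_minus, cos_plus. ring.
Qed.

Lemma sum_cos_mult (M : nat) (s : R) :
  2 * sin (s / 2) * Rsum (fun m => cos (INR m * s)) M
  = sin ((INR M + 1 / 2) * s) - sin (s / 2).
Proof.
  induction M as [|M IH].
  - rewrite Rsum_0. simpl INR.
    replace ((0 + 1 / 2) * s) with (s / 2) by field. ring.
  - rewrite Rsum_succ, Rmult_plus_distr_l, IH.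
    replace ((INR M + 1 / 2) * s) with (INR (S M) * s - s / 2) by (rewrite S_INR; field).
    replace ((INR (S M) + 1 / 2) * s) with (INR (S M) * s + s / 2) by field.
    rewrite sin_minus, sin_plus. ring.
Qed.

Lemma is_derive_cos_log_partial (M : nat) (s : R) :
  is_derive (cos_log_partial M) s (- Rsum (fun m => sin (INR m * s)) M).
Proof.
  unfold cos_log_partial. induction M as [|M IH].
  - rewrite Rsum_0. rewrite Ropp_0.
    apply is_derive_ext with (fun _ => 0).
    + intros t. now rewrite Rsum_0.
    + apply (is_derive_const (V := R_NormedModule)).
  - apply is_derive_ext with
      (fun s => Rsum (fun m => cos (INR m * s) / INR m) M
                + cos (INR (S M) * s) / INR (S M)).
    + intros t. now rewrite Rsum_succ.
    + rewrite Rsum_succ, Ropp_plus_distr.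
      apply (is_derive_plus (V := R_NormedModule)); [exact IH|].
      generalize (INR (S M)) (not_0_INR (S M) ltac:(lia)). intros c Hc.
      auto_derive; [exact I|]. now field.
Qed.

Lemma sin_half_pos (s : R) : 0 < s < 2 * PI -> 0 < sin (s / 2).
Proof. intros Hs. apply sin_gt_0; lra. Qed.

(** [sin (s / 2)] rises up to [PI] and falls afterwards, so on the segment from [PI] to [th] it is
    least at [th]. This makes the derivative bound of [cos_log_error] uniform there. *)
Lemma sin_half_ge_of_between_PI (th s : R) : 0 < th < 2 * PI ->
  Rmin PI th <= s <= Rmax PI th -> sin (th / 2) <= sin (s / 2).
Proof.
  intros Hth Hs. destruct (Rle_lt_dec th PI).
  - rewrite Rmin_right, Rmax_left in Hs by assumption. apply sin_incr_1; lra.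
  - rewrite Rmin_left, Rmax_right in Hs by lra. apply sin_decr_1; lra.
Qed.

(* The subtracted oscillating term cancels the Dirichlet-kernel part of the
   derivative of the partial sum, leaving a derivative of size O(1 / M). *)
Definition cos_log_error (M : nat) (s : R) : R :=
  cos_log_partial M s + ln (2 * sin (s / 2))
  - sin ((INR M + 1 / 2) * s) / ((2 * INR M + 1) * sin (s / 2)).

Lemma is_derive_cos_log_error (M : nat) (s : R) : 0 < s < 2 * PI ->
  is_derive (cos_log_error M) s
    (sin ((INR M + 1 / 2) * s) * cos (s / 2)
     / (2 * (2 * INR M + 1) * sin (s / 2) ^ 2)).
Proof.
  intros Hs. pose proof (sin_half_pos s Hs) as P. pose proof (pos_INR M) as PM.
  evar_last.
  - apply (is_derive_minus (V := R_NormedModule));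
      [apply (is_derive_plus (V := R_NormedModule));
        [apply is_derive_cos_log_partial|]|].
    + auto_derive; [|reflexivity]. unfold Rdiv in P. lra.
    + auto_derive; [|reflexivity]. unfold Rdiv in P. apply Rgt_not_eq. apply Rmult_lt_0_compat; lra.
  - replace (Rsum (fun m => sin (INR m * s)) M) with
      ((cos (s / 2) - cos ((INR M + 1 / 2) * s)) / (2 * sin (s / 2)))
      by (rewrite <- sum_sin_mult; field; lra).
    unfold minus, plus, opp; simpl. change (s * / 2) with (s / 2).
    change (1 * / 2) with (1 / 2). field. lra.
Qed.

Lemma cos_log_error_variation (M : nat) (th : R) : 0 < th < 2 * PI ->
  Rabs (cos_log_error M th - cos_log_error M PI)
  <= PI / (2 * sin (th / 2) ^ 2) / (2 * INR M + 1).
Proof.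
  intros Hth. pose proof (sin_half_pos th Hth) as P. pose proof (pos_INR M) as PM.
  pose proof PI_RGT_0 as Ppi.
  assert (R : forall s, Rmin PI th <= s <= Rmax PI th -> 0 < s < 2 * PI).
  { intros s Hs. pose proof (Rmin_glb_lt PI th 0 Ppi ltac:(lra)).
    pose proof (Rmax_lub_lt PI th (2 * PI) ltac:(lra) ltac:(lra)). lra. }
  destruct (MVT_gen (cos_log_error M) PI th
    (fun s => sin ((INR M + 1 / 2) * s) * cos (s / 2)
     / (2 * (2 * INR M + 1) * sin (s / 2) ^ 2))) as [s [Hs E]].
  - intros s Hs. apply is_derive_cos_log_error, R. lra.
  - intros s Hs. apply continuity_pt_filterlim.
    apply (ex_derive_continuous (V := R_NormedModule)).
    eexists. now apply is_derive_cos_log_error, R.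
  - rewrite E, Rabs_mult.
    pose proof (sin_half_ge_of_between_PI th s Hth Hs) as Hsin.
    assert (Hlen : Rabs (th - PI) <= PI) by (apply Rabs_le; lra).
    (* Splits the bound into a bound for the derivative times [PI], a bound for the length of the
       segment. *)
    replace (PI / (2 * sin (th / 2) ^ 2) / (2 * INR M + 1))
      with (1 / (2 * (2 * INR M + 1) * sin (th / 2) ^ 2) * PI) by (field; lra).
    apply Rmult_le_compat; try apply Rabs_pos; [|exact Hlen].
    assert (Q : 0 < 2 * (2 * INR M + 1) * sin (th / 2) ^ 2).
    { apply Rmult_lt_0_compat; [lra|]. now apply pow_lt. }
    assert (Q' : 2 * (2 * INR M + 1) * sin (th / 2) ^ 2 <= 2 * (2 * INR M + 1) * sin (s / 2) ^ 2).
    { apply Rmult_le_compat_l; [lra|]. apply pow_incr. lra. }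
    rewrite Rabs_div, (Rabs_pos_eq (2 * _ * _)) by lra.
    unfold Rdiv at 1 4. apply Rmult_le_compat.
    + apply Rabs_pos.
    + left. apply Rinv_0_lt_compat. lra.
    + rewrite Rabs_mult, <- (Rmult_1_l 1).
      apply Rmult_le_compat; try apply Rabs_pos; apply Rabs_le;
      [apply SIN_bound|apply COS_bound].
    + apply Rinv_le_contravar; lra.
Qed.

Lemma is_lim_seq_bounded_div_odd (u : nat -> R) (K : R) :
  (forall M, Rabs (u M) <= K / (2 * INR M + 1)) -> is_lim_seq u 0.
Proof.
  intros H. apply is_lim_seq_abs_0.
  apply is_lim_seq_le_le_loc with (fun _ => 0) (fun M => Rabs K / INR M);
    [|apply is_lim_seq_const|apply is_lim_seq_const_div_INR].
  exists 1%nat. intros M HM. split; [apply Rabs_pos|].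
  assert (HP : 0 < INR M) by (apply lt_0_INR; lia).
  eapply Rle_trans; [apply H|]. pose proof (Rle_abs K). pose proof (Rabs_pos K).
  apply Rle_trans with (Rabs K / (2 * INR M + 1)).
  - apply Rmult_le_compat_r; [left; apply Rinv_0_lt_compat; lra|assumption].
  - apply Rmult_le_compat_l; [assumption|]. apply Rinv_le_contravar; lra.
Qed.

Lemma cos_log_remainder_lim (th : R) : 0 < th < 2 * PI ->
  is_lim_seq (fun M => sin ((INR M + 1 / 2) * th) / ((2 * INR M + 1) * sin (th / 2))) 0.
Proof.
  intros Hth. pose proof (sin_half_pos th Hth) as P.
  apply is_lim_seq_bounded_div_odd with (/ sin (th / 2)). intros M.
  pose proof (pos_INR M) as PM.
  rewrite Rabs_div by (apply Rgt_not_eq; apply Rmult_lt_0_compat; lra).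
  rewrite (Rabs_pos_eq (_ * _)) by (apply Rmult_le_pos; lra).
  replace (/ sin (th / 2) / (2 * INR M + 1)) with (1 / ((2 * INR M + 1) * sin (th / 2)))
    by (field; lra).
  apply Rmult_le_compat_r.
  - left. apply Rinv_0_lt_compat. apply Rmult_lt_0_compat; lra.
  - apply Rabs_le, SIN_bound.
Qed.

Lemma cos_log_partial_lim (th : R) : 0 < th < 2 * PI ->
  is_lim_seq (fun N => cos_log_partial (2 * N) th) (- ln (2 * sin (th / 2))).
Proof.
  intros Hth. pose proof PI_RGT_0 as Ppi.
  pose proof (is_lim_seq_bounded_div_odd _ _
    (fun M => cos_log_error_variation M th Hth)) as V.
  pose proof (is_lim_seq_double _ _ V) as V2.
  pose proof (is_lim_seq_double _ _ (cos_log_remainder_lim th Hth)) as R2.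
  pose proof (is_lim_seq_double _ _ (cos_log_remainder_lim PI ltac:(lra))) as R2pi.
  (* The partial sum at [th] is the variation of the error from [PI], plus the partial sum at [PI],
     plus the difference of the oscillating terms, plus the difference of the logarithms. *)
  pose proof (is_lim_seq_plus' _ _ _ _
    (is_lim_seq_minus' _ _ _ _ (is_lim_seq_plus' _ _ _ _
      (is_lim_seq_plus' _ _ _ _ V2 cos_log_partial_PI_lim) R2) R2pi)
    (is_lim_seq_const (ln 2 - ln (2 * sin (th / 2))))) as L.
  replace (0 + - ln 2 + 0 - 0 + (ln 2 - ln (2 * sin (th / 2))))
    with (- ln (2 * sin (th / 2))) in L by ring.
  eapply is_lim_seq_ext; [|exact L]. intros N. unfold cos_log_error.
  rewrite sin_PI2, !Rmult_1_r. ring.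
Qed.

(** * Gauss's digamma formula *)

Lemma cos_2PI_nat_shift (s : R) (n l p k : nat) : INR n * s = 2 * PI * INR l ->
  cos (INR (n * p + k) * s) = cos (INR k * s).
Proof.
  intros Hs. rewrite <- (cos_period (INR k * s) (p * l)). f_equal.
  rewrite plus_INR, !mult_INR.
  replace ((INR n * INR p + INR k) * s) with (INR p * (INR n * s) + INR k * s) by ring.
  rewrite Hs. ring.
Qed.

Lemma Rsum_cos_full_period (n l : nat) (s : R) : 0 < s < 2 * PI ->
  INR n * s = 2 * PI * INR l -> Rsum (fun k => cos (INR k * s)) n = 0.
Proof.
  intros Hs Hn. pose proof (sin_half_pos s Hs) as P.
  apply (Rmult_eq_reg_l (2 * sin (s / 2))); [|lra].
  rewrite sum_cos_mult, Rmult_0_r.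
  replace ((INR n + 1 / 2) * s) with (s / 2 + 2 * INR l * PI).
  - rewrite sin_period. ring.
  - rewrite Rmult_plus_distr_r, Hn. field.
Qed.

(* Each unit shift of the digamma arguments extends the cosine sum by one period. *)
Lemma Rsum_cos_digamma_shift (n l N : nat) (s : R) : (0 < n)%nat ->
  INR n * s = 2 * PI * INR l ->
  Rsum (fun k => cos (INR k * s) * digamma (INR k / INR n + INR N)) n
  = Rsum (fun k => cos (INR k * s) * digamma (INR k / INR n)) n
    + INR n * cos_log_partial (n * N) s.
Proof.
  intros Hn Hs. assert (Pn : 0 < INR n) by (now apply lt_0_INR).
  unfold cos_log_partial. induction N as [|N IH].
  - rewrite Nat.mul_0_r, Rsum_0, Rmult_0_r, Rplus_0_r.
    apply Rsum_ext. intros k _. simpl INR. now rewrite Rplus_0_r.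
  - rewrite Nat.mul_succ_r, Rsum_offset, Rmult_plus_distr_l, <- Rplus_assoc, <- IH,
      <- Rsum_scal, <- Rsum_plus.
    apply Rsum_ext. intros k Hk. rewrite (cos_2PI_nat_shift s n l N k Hs).
    assert (0 < INR k) by (apply lt_0_INR; lia). pose proof (pos_INR N).
    assert (0 < INR k / INR n) by (now apply Rdiv_lt_0_compat).
    replace (INR k / INR n + INR (S N)) with (INR k / INR n + INR N + 1)
      by (rewrite S_INR; ring).
    (* The increment [/ (k / n + N)] of psi is [n / (n * N + k)], the coefficient of the series term
       of index [n * N + k]. *)
    rewrite digamma_plus_1, plus_INR, mult_INR by lra. field. nra.
Qed.

Lemma Rsum_cos_digamma_full (n l : nat) : (0 < l < n)%nat ->
  Rsum (fun k => cos (INR k * (2 * PI * INR l / INR n)) * digamma (INR k / INR n)) n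
  = INR n * ln (2 * sin (PI * INR l / INR n)).
Proof.
  intros Hl. set (s := 2 * PI * INR l / INR n).
  assert (Pl : 0 < INR l) by (apply lt_0_INR; lia).
  assert (Pln : INR l < INR n) by (apply lt_INR; lia).
  pose proof PI_RGT_0 as Ppi.
  assert (Hs : INR n * s = 2 * PI * INR l) by (unfold s; field; lra).
  assert (Rs : 0 < s < 2 * PI).
  { split.
    - unfold s. apply Rdiv_lt_0_compat; nra.
    - unfold s. apply Rlt_div_l; nra. }
  replace (PI * INR l / INR n) with (s / 2) by (unfold s; field; lra).
  set (T := Rsum _ n).
  (* One sequence receives two limits: [L1] from the cosine series, [L2] from the asymptotics of
     psi. The index is even because the limit of the series is known along even lengths. *)
  assert (L1 : is_lim_seq (fun N => T + INR n * cos_log_partial (2 * (n * N)) s)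
                 (T + INR n * - ln (2 * sin (s / 2)))).
  { apply is_lim_seq_plus'; [apply is_lim_seq_const|].
    apply (is_lim_seq_scal_l (fun N => cos_log_partial (2 * (n * N)) s) (INR n)
      (Finite (- ln (2 * sin (s / 2))))).
    apply (is_lim_seq_subseq (fun N => cos_log_partial (2 * N) s) _ (fun N => n * N)%nat).
    - apply eventually_subseq. intros. nia.
    - now apply cos_log_partial_lim. }
  assert (L2 : is_lim_seq (fun N => T + INR n * cos_log_partial (2 * (n * N)) s) 0).
  { apply is_lim_seq_ext with (fun N => Rsum (fun k => cos (INR k * s) *
      (digamma (INR k / INR n + INR (2 * N)) - ln (INR (2 * N)))) n).
    - intros N. replace (2 * (n * N))%nat with (n * (2 * N))%nat by lia.
      unfold T. rewrite <- (Rsum_cos_digamma_shift n l) by (lia || exact Hs).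
      rewrite <- (Rplus_0_r (Rsum (fun k => _ * digamma (_ + _)) n)).
      (* The cosines sum to zero over a period, so [ln (2 * N)] can be subtracted from every digamma
         value at once. *)
      replace 0 with (- ln (INR (2 * N)) * Rsum (fun k => cos (INR k * s)) n)
        by (rewrite (Rsum_cos_full_period n l s Rs Hs); ring).
      rewrite <- Rsum_scal, <- Rsum_plus.
      apply Rsum_ext. intros k _. ring.
    - replace 0 with (Rsum (fun k => 0 * 0) n) by (rewrite Rsum_scal; ring).
      apply (is_lim_seq_double (fun N => Rsum (fun k => cos (INR k * s) *
        (digamma (INR k / INR n + INR N) - ln (INR N))) n)).
      apply is_lim_seq_Rsum. intros k Hk.
      replace (Finite (0 * 0)) with (Rbar_mult (cos (INR k * s)) 0)
        by (simpl; f_equal; ring).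
      apply (is_lim_seq_scal_l _ (cos (INR k * s)) 0).
      apply digamma_plus_INR_minus_ln_lim.
      apply Rdiv_lt_0_compat; [apply lt_0_INR; lia|lra]. }
  apply is_lim_seq_unique in L1. apply is_lim_seq_unique in L2.
  rewrite L1 in L2. injection L2. lra.
Qed.

(** The term [k = n] of the full-period sum is [cos (2 * PI * l) * digamma 1 = - euler_gamma];
    dropping it adds [euler_gamma]. *)
Lemma gauss_cos_digamma_sum (n l : nat) : (0 < l < n)%nat ->
  Rsum (fun k => digamma (INR k / INR n) * cos (2 * PI * INR k * INR l / INR n)) (n - 1)
  = INR n * ln (2 * sin (PI * INR l / INR n)) + euler_gamma.
Proof.
  intros Hl. rewrite euler_gamma_eq, <- (Rsum_cos_digamma_full n l Hl).
  assert (Pn : 0 < INR n) by (apply lt_0_INR; lia).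
  assert (E : INR n * (2 * PI * INR l / INR n) = 0 + 2 * INR l * PI) by (field; lra).
  assert (Last : forall f, Rsum f n = Rsum f (n - 1) + f n).
  { intros f. replace (f n) with (f (S (n - 1))) by (f_equal; lia).
    rewrite <- Rsum_succ. f_equal. lia. }
  rewrite Last, E, cos_period, cos_0, Rdiv_diag by lra.
  replace (1 * digamma 1) with (digamma 1) by ring.
  rewrite Rplus_assoc, Rplus_opp_r, Rplus_0_r.
  apply Rsum_ext. intros k _. rewrite Rmult_comm. do 2 f_equal. field. lra.
Qed.

(** * Logarithm of the product and exchange of the two sums *)

Lemma prod_n_m_succ (f : nat -> R) (m : nat) :
  prod_n_m f 1 (S m) = prod_n_m f 1 m * f (S m).
Proof.
  unfold prod_n_m.
  rewrite (Iter.iter_nat_Chasles Rmult 1 Rmult_1_l) with (m := m); try lia.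
  - f_equal. apply Iter.iter_nat_point, Rmult_1_r.
  - intros. ring.
Qed.

(** Positivity is part of the induction because [ln_mult] requires it of the partial product. *)
Lemma ln_prod_Rpower (f g : nat -> R) (m : nat) :
  0 < prod_n_m (fun k => Rpower (f k) (g k)) 1 m /\
  ln (prod_n_m (fun k => Rpower (f k) (g k)) 1 m) = Rsum (fun k => g k * ln (f k)) m.
Proof.
  induction m as [|m [P IH]].
  - rewrite Rsum_0. unfold prod_n_m, Iter.iter_nat; simpl. split; [lra|apply ln_1].
  - rewrite prod_n_m_succ, Rsum_succ. split.
    + apply Rmult_lt_0_compat; [exact P|apply Rpower_pos].
    + rewrite ln_mult, IH, ln_Rpower by (exact P || apply Rpower_pos). reflexivity.
Qed.

Theorem mainTheorem11 (n : nat) (hn : (2 <= n)%nat) :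
  sum_n_m (fun nu => digamma (INR nu / INR n) * cos_csc_sum n nu) 1 (n - 1)
  = (euler_gamma + INR n * ln 2) * csc_sum n
    - INR n * ln (prod_n_m (fun nu => Rpower (csc (PI * INR nu / INR n))
                                             (csc (PI * INR nu / INR n)))
                           1 (n - 1)).
Proof.
  set (c := fun l : nat => csc (PI * INR l / INR n)).
  set (u := fun nu l : nat =>
    digamma (INR nu / INR n) * (cos (2 * PI * INR nu * INR l / INR n) * c l)).
  change (csc_sum n) with (Rsum c (n - 1)).
  change (Rsum (fun nu => digamma (INR nu / INR n) *
    Rsum (fun l => cos (2 * PI * INR nu * INR l / INR n) * c l) (n - 1)) (n - 1)
  = (euler_gamma + INR n * ln 2) * Rsum c (n - 1)
    - INR n * ln (prod_n_m (fun nu => Rpower (c nu) (c nu)) 1 (n - 1))).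
  rewrite (proj2 (ln_prod_Rpower c c (n - 1))).
  rewrite (Rsum_ext _ (fun nu => Rsum (u nu) (n - 1)))
    by (intros; symmetry; apply Rsum_scal).
  rewrite Rsum_exchange.
  unfold Rminus. rewrite Ropp_mult_distr_l, <- !Rsum_scal, <- Rsum_plus.
  apply Rsum_ext. intros l Hl.
  rewrite (Rsum_ext _ (fun nu => c l * (digamma (INR nu / INR n) *
    cos (2 * PI * INR nu * INR l / INR n)))) by (intros; unfold u; ring).
  rewrite Rsum_scal, gauss_cos_digamma_sum by lia.
  assert (Pl : 0 < INR l) by (apply lt_0_INR; lia).
  assert (Pln : INR l < INR n) by (apply lt_INR; lia).
  pose proof PI_RGT_0 as Ppi.
  assert (Ps : 0 < sin (PI * INR l / INR n)).
  { apply sin_gt_0; [apply Rdiv_lt_0_compat; nra|apply Rlt_div_l; nra]. }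
  (* [ln (2 * sin y) = ln 2 - ln (csc y)]: the first part joins the coefficient of [csc_sum], the
     second gives the logarithm of the product. *)
  rewrite ln_mult by lra. unfold c at 4, csc at 1. rewrite ln_Rinv by exact Ps. ring.
Qed.
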